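(* Let $n\ge 1$ and, for $k=1,\dots,n$, let $\tau_k=s_0 s_1\cdots s_{k-1}\in B_n$. Then every element $g\in B_n$ has a unique presentation of the form $$g=\tau_1^{i_1}\cdot\tau_2^{i_2}\cdots\tau_n^{i_n},$$ where the exponents are integers satisfying $-k\le i_k<k$ for every $1\le k\le n$.
   Context: $B_n$ is the group of signed permutations, i.e. the bijections $\pi$ of $\{\pm1,\dots,\pm n\}$ with $\pi(-i)=-\pi(i)$ for all $i$. It is a Coxeter group with generators $s_0,s_1,\dots,s_{n-1}$, where $s_0$ exchanges $1$ and $-1$ (fixing everything else), and for $1\le i\le n-1$, $s_i$ exchanges $i$ with $i+1$ and $-i$ with $-(i+1)$. Products are read from left to right: $(\pi_1\cdot\pi_2)(i)=\pi_2(\pi_1(i))$. *)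

(* Defs.v *)
From HB Require Import structures.
From mathcomp Require Import all_boot all_order all_algebra all_fingroup.
Set Implicit Arguments.
Unset Strict Implicit.
Unset Printing Implicit Defensive.
Import Order.TTheory GRing.Theory Num.Theory.
Local Open Scope group_scope.

(* The set {±1, ..., ±n}: (false, i) is the integer i+1 and (true, i) is the
   integer -(i+1); see [spt_val] below. *)
Definition spt (n : nat) : finType := (bool * 'I_n)%type.

Definition spt_opp (n : nat) (x : spt n) : spt n := (~~ x.1, x.2).

Definition spt_val (n : nat) (x : spt n) : int :=
  (if x.1 then - (x.2.+1)%:Z else (x.2.+1)%:Z)%R.

Lemma spt_val_inj (n : nat) : injective (@spt_val n).
Proof.
move=> [[] i] [[] j]; rewrite /spt_val //= => /eqP.
- by rewrite eqr_opp => /eqP[/val_inj->].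
- by move=> /eqP [/val_inj->].
Qed.

Lemma spt_valP (n : nat) (z : int) :
  reflect (exists x : spt n, spt_val x = z) ((z != 0%R) && (`|z| <= n)%N).
Proof.
apply: (iffP andP) => [[]|[[b i] <-]].
  case: z => [[|m]|m] //= _ ltmn; first by exists (false, Ordinal ltmn).
  by exists (true, Ordinal ltmn); rewrite /spt_val /= NegzE.
by case: b; rewrite /spt_val /= ?abszN ltn_ord.
Qed.

Lemma spt_val_opp (n : nat) (x : spt n) : spt_val (spt_opp x) = (- spt_val x)%R.
Proof. by case: x => [[] i]; rewrite /spt_val //= opprK. Qed.

(* The product of {perm T} already reads left to right:
   (p * q) x = q (p x) (lemma permM). *)
Definition signed_perms (n : nat) : {set {perm (spt n)}} :=
  [set p : {perm (spt n)} | [forall x, p (spt_opp x) == spt_opp (p x)]].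

Lemma signed_permsP (n : nat) (p : {perm (spt n)}) :
  reflect (forall x, p (spt_opp x) = spt_opp (p x)) (p \in signed_perms n).
Proof. by rewrite inE; apply: 'forall_eqP. Qed.

Lemma signed_perms_group_set (n : nat) : group_set (signed_perms n).
Proof.
apply/group_setP; split=> [|p q /signed_permsP Bp /signed_permsP Bq].
  by apply/signed_permsP=> x; rewrite !perm1.
by apply/signed_permsP=> x; rewrite !permM Bp Bq.
Qed.

Canonical signed_perms_group (n : nat) : {group {perm (spt n)}} :=
  Group (signed_perms_group_set n).

(* The generator s_i, 0 <= i < n. For i > 0 the integers i and i+1 are encoded
   by the ordinals i-1 = ord_pred i and i (ord_pred only wraps around at 0). *)
Definition sgen (n : nat) (i : 'I_n) : {perm (spt n)} :=
  if i == 0 :> nat then tperm (false, i) (true, i)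
  else tperm (false, ord_pred i) (false, i) * tperm (true, ord_pred i) (true, i).

(* For k : 'I_n this is tau_{k+1} = s_0 s_1 ... s_k; the product is taken in
   increasing order of the index. *)
Definition tau (n : nat) (k : 'I_n) : {perm (spt n)} :=
  \prod_(j < n | (j <= k)%N) sgen j.

Definition expgz (gT : finGroupType) (x : gT) (z : int) : gT :=
  match z with Posz m => x ^+ m | Negz m => x ^- m.+1 end.

(* Main.v *)
(* Writing [n] for the largest point moved by tau_n, the map tau_n is the
   2n-cycle n -> n-1 -> ... -> 1 -> -n -> ... -> -1 -> n, so the powers
   tau_n^i with -n <= i < n send n to each of ±1, ..., ±n exactly once.  The
   factors tau_1, ..., tau_{n-1} fix n, hence g(n) determines i_n, and
   g tau_n^{-i_n} fixes n, i.e. lies in B_{n-1}; conclude by induction. *)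
Require Import Defs.
From HB Require Import structures.
From mathcomp Require Import all_boot all_order all_algebra all_fingroup.
From mathcomp Require Import zify.
Set Implicit Arguments.
Unset Strict Implicit.
Unset Printing Implicit Defensive.
Import Order.TTheory GRing.Theory Num.Theory.
Local Open Scope group_scope.

(** Peels off the last factor of a partial product while the index type stays ['I_n], so that
    inductions on the length take place in one fixed group. *)
Lemma big_ord_prefix_recr (T : Type) (idx : T) (op : Monoid.law idx) (n : nat)
    (k : 'I_n) (F : 'I_n -> T) :
  \big[op/idx]_(j < n | (j < k.+1)%N) F j =
  op (\big[op/idx]_(j < n | (j < k)%N) F j) (F k).
Proof.
rewrite (big_ord_narrow (ltn_ord k)) big_ord_recr /=.
rewrite (big_ord_narrow (ltnW (ltn_ord k))).
congr (op _ (F _)); last exact: val_inj.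
by apply: eq_bigr => i _; congr F; apply: val_inj.
Qed.

Lemma expgz_in (gT : finGroupType) (G : {group gT}) (x : gT) (z : int) :
  x \in G -> expgz x z \in G.
Proof. by case: z => m Gx /=; rewrite ?groupV groupX. Qed.

Lemma val_ord_pred (n : nat) (i : 'I_n) : (0 < i)%N -> ord_pred i = i.-1 :> nat.
Proof.
move=> i_gt0 /=; rewrite -(prednK i_gt0) addSn /= modnDr modn_small //.
by rewrite (leq_ltn_trans (leq_pred _)).
Qed.

Lemma sgen0E (n : nat) (i : 'I_n) (b : bool) (x : 'I_n) :
  i = 0 :> nat -> sgen i (b, x) = (if x == i then ~~ b else b, x).
Proof.
move=> i0; rewrite /sgen i0 eqxx; have [->|xi] := eqVneq x i.
  by case: b; rewrite ?tpermL ?tpermR.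
by rewrite tpermD // xpair_eqE [i == x]eq_sym (negPf xi) andbF.
Qed.

Lemma sgenSE (n : nat) (i : 'I_n) (b : bool) (x : 'I_n) :
  (0 < i)%N -> sgen i (b, x) = (b, tperm (ord_pred i) i x).
Proof.
rewrite lt0n /sgen => /negPf->; rewrite permM.
have tpairE c d (y : 'I_n) : tperm (c, ord_pred i) (c, i) (d, y) =
    (d, if c == d then tperm (ord_pred i) i y else y).
  have [<-|cd] := eqVneq c d; last by rewrite tpermD // xpair_eqE (negPf cd).
  by rewrite !permE /= !xpair_eqE !eqxx /=; do 2!case: ifP => // _.
by rewrite !tpairE; case: b.
Qed.

(** Induction on [k]: each new generator only touches the indices [k - 1] and [k]. It carries the
    image of index 0 one step further and moves index [k], fixed so far, down to [k - 1]. *)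
Lemma tauE (n : nat) (k : 'I_n) (b : bool) (x : 'I_n) :
  tau k (b, x) = if (x == 0 :> nat)%N then (~~ b, k)
                 else if (x <= k)%N then (b, ord_pred x) else (b, x).
Proof.
case: k => m; elim: m => [|m IH] ltmn; rewrite /tau.
  rewrite (big_ord_prefix_recr _ (Ordinal ltmn)) big_pred0 //= mul1g sgen0E //=.
  rewrite -val_eqE /= leqn0; case: eqP => // x0.
  by congr (_, _); apply: val_inj.
rewrite (big_ord_prefix_recr _ (Ordinal ltmn)) permM -/(tau (Ordinal (ltnW ltmn))).
rewrite IH /=; set k := Ordinal ltmn.
have predk : ord_pred k = Ordinal (ltnW ltmn).
  by apply: ord_inj; rewrite val_ord_pred.
case: ifP => [_|x0]; first by rewrite sgenSE // predk tpermL.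
have x_gt0 : (0 < x)%N by rewrite lt0n x0.
rewrite [in RHS]leq_eqVlt ltnS; case: leqP => [lexm|ltmx].
  rewrite orbT sgenSE // predk tpermD // -(inj_eq (@ord_inj n));
    by rewrite val_ord_pred //=; lia.
rewrite orbF sgenSE //; case: eqP => [xk|xk].
  by have -> : x = k; [apply: ord_inj | rewrite tpermR].
by rewrite tpermD // -(inj_eq (@ord_inj n)) ?predk /=; lia.
Qed.

Lemma tau_signed (n : nat) (k : 'I_n) : tau k \in signed_perms n.
Proof.
apply/signed_permsP => -[b x]; rewrite /spt_opp !tauE /=.
by case: ifP => // _; case: ifP.
Qed.

(** The index drops by one at each step; a sign change needs a step from index 0, and the [t] steps
    all start higher. *)
Lemma tauX (n : nat) (k : 'I_n) (b : bool) (t : nat) (x y : 'I_n) :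
  (y <= k)%N -> y = (x + t)%N :> nat -> (tau k ^+ t) (b, y) = (b, x).
Proof.
elim: t y => [|t IH] y leyk yE.
  by rewrite perm1; congr (_, _); apply: ord_inj; rewrite yE addn0.
rewrite expgS permM tauE leyk ifF; last by lia.
by apply: IH; rewrite val_ord_pred; lia.
Qed.

Lemma tauX_wrap (n : nat) (k : 'I_n) (b : bool) (x : 'I_n) :
  (x <= k)%N -> (tau k ^+ x.+1) (b, x) = (~~ b, k).
Proof.
move=> lexk; have x0n : (0 < n)%N by rewrite (leq_ltn_trans _ (ltn_ord x)).
by rewrite expgSr permM (@tauX _ _ _ _ (Ordinal x0n)) // tauE.
Qed.

(* The exponent sending the top point k+1 to p. *)
Definition tau_exponent (n : nat) (k : 'I_n) (p : spt n) : int :=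
  if p.1 then Negz p.2 else Posz (k - p.2).

Lemma expgz_tau_exponent (n : nat) (k : 'I_n) (p : spt n) :
  (p.2 <= k)%N -> expgz (tau k) (tau_exponent k p) (false, k) = p.
Proof.
case: p => -[] x lexk; last by rewrite /= (@tauX _ _ _ _ x) //= subnKC.
(* The exponent [Negz x] stands for the inverse of the power [x.+1]; applying that power to both
   sides reduces the claim to the wrap-around. *)
apply: (@perm_inj _ (tau k ^+ x.+1)).
by rewrite /= permKV tauX_wrap.
Qed.

Lemma tau_exponent_range (n : nat) (k : 'I_n) (p : spt n) : (p.2 <= k)%N ->
  (- (k.+1)%:Z <= tau_exponent k p < (k.+1)%:Z)%R.
Proof. by case: p => -[] x /= lexk; rewrite /tau_exponent /=; lia. Qed.

Lemma tau_exponent_onto (n : nat) (k : 'I_n) (z : int) :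
  (- (k.+1)%:Z <= z < (k.+1)%:Z)%R ->
  exists2 p : spt n, (p.2 <= k)%N & z = tau_exponent k p.
Proof.
case: z => t zk.
  have ltn_kt : (k - t < n)%N by rewrite (leq_ltn_trans (leq_subr _ _)).
  by exists (false, Ordinal ltn_kt); rewrite /tau_exponent /=; lia.
have letk : (t <= k)%N by lia.
by exists (true, Ordinal (leq_ltn_trans letk (ltn_ord k))).
Qed.

(** Both exponents are values of [tau_exponent k], and evaluation at the top point recovers its
    argument. *)
Lemma expgz_tau_inj (n : nat) (k : 'I_n) (z1 z2 : int) :
  (- (k.+1)%:Z <= z1 < (k.+1)%:Z)%R -> (- (k.+1)%:Z <= z2 < (k.+1)%:Z)%R ->
  expgz (tau k) z1 (false, k) = expgz (tau k) z2 (false, k) -> z1 = z2.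
Proof.
move=> /tau_exponent_onto[p1 le1 ->] /tau_exponent_onto[p2 le2 ->].
by rewrite !expgz_tau_exponent // => ->.
Qed.

Lemma expgz_tau_fix (n : nat) (k : 'I_n) (z : int) (p : spt n) :
  (k < p.2)%N -> expgz (tau k) z p = p.
Proof.
(* The stabiliser of [p] is a subgroup, so only [tau k] itself has to be checked. *)
move=> ltkp; rewrite -apermE; apply/(astab1P (to := 'P))/expgz_in/(astab1P (to := 'P)).
by case: p ltkp => b x /= ltkx; rewrite /= apermE tauE ifF ?ifF //; lia.
Qed.

Lemma prod_tau_fix (n m : nat) (f : 'I_n -> int) (p : spt n) : (m <= p.2)%N ->
  (\prod_(k < n | (k < m)%N) expgz (tau k) (f k)) p = p.
Proof.
move=> lemp; rewrite -apermE; apply/(astab1P (to := 'P))/group_prod => k ltkm.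
by apply/(astab1P (to := 'P))/expgz_tau_fix/(leq_trans ltkm).
Qed.

(** The smaller group $B_m$ appears as the signed permutations that fix every point of index at
    least [m], so the induction on [m] stays inside $B_n$. *)
Lemma prod_tau_exists (n m : nat) (g : {perm (spt n)}) : (m <= n)%N ->
  g \in signed_perms n -> (forall p : spt n, (m <= p.2)%N -> g p = p) ->
  exists2 f : 'I_n -> int,
    forall k : 'I_n, (- (k.+1)%:Z <= f k < (k.+1)%:Z)%R &
    g = \prod_(k < n | (k < m)%N) expgz (tau k) (f k).
Proof.
elim: m g => [|m IH] g lemn gB gfix.
  (* Exponents outside the partial product must still lie in their range; 0 does for every [k]. *)
  exists (fun=> 0%R) => [k|]; first by lia.
  by rewrite big_pred0 //; apply/permP => p; rewrite perm1 gfix.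
pose k := Ordinal lemn; pose p := g (false, k).
(* Otherwise [g] would fix [p], the image of the top point, and injectivity would make [p] the top
   point itself. *)
have lepk : (p.2 <= k)%N.
  rewrite leqNgt; apply/negP => ltkp.
  by have /perm_inj pE := gfix p ltkp; rewrite pE ltnn in ltkp.
pose z := tau_exponent k p; pose t := expgz (tau k) z.
have tB : t^-1 \in signed_perms n by rewrite groupV expgz_in // tau_signed.
have hB : g * t^-1 \in signed_perms n by rewrite groupM.
have hk : (g * t^-1) (false, k) = (false, k).
  by rewrite permM -/p -{1}(expgz_tau_exponent lepk) permK.
have [q leq_mq|f frange hE] := IH _ (ltnW lemn) hB.
  have [ltmq|] := ltnP m q.2.
    by rewrite permM gfix // -{1}(@expgz_tau_fix _ k z q ltmq) permK.
  case: q leq_mq => b x /= lemx lexm.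
  have -> : x = k by apply: val_inj; apply/eqP; rewrite eqn_leq lexm.
  (* The negative of the top point is fixed too, because [g * t^-1] commutes with the sign
     change. *)
  by case: b => //; rewrite (elimT (signed_permsP _) hB (false, k)) hk.
exists (fun j => if j == k then z else f j) => [j|].
  by case: eqP => [->|_]; [apply: tau_exponent_range | apply: frange].
rewrite (big_ord_prefix_recr _ k) eqxx -[g in LHS](mulgKV t) hE.
congr (_ * _); apply: eq_bigr => j ltjm.
by rewrite -val_eqE ltn_eqF.
Qed.

(** All factors but the last fix the top point, so its image determines the last exponent; the last
    factor then cancels on the right. *)
Lemma prod_tau_inj (n m : nat) (f1 f2 : 'I_n -> int) : (m <= n)%N ->
  (forall k : 'I_n, (- (k.+1)%:Z <= f1 k < (k.+1)%:Z)%R) ->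
  (forall k : 'I_n, (- (k.+1)%:Z <= f2 k < (k.+1)%:Z)%R) ->
  \prod_(k < n | (k < m)%N) expgz (tau k) (f1 k) =
    \prod_(k < n | (k < m)%N) expgz (tau k) (f2 k) ->
  forall k : 'I_n, (k < m)%N -> f1 k = f2 k.
Proof.
move=> lemn f1P f2P; elim: m lemn => // m IH lemn.
pose k := Ordinal lemn; rewrite !(big_ord_prefix_recr _ k) => prodE.
have fk : f1 k = f2 k.
  apply: expgz_tau_inj (f1P k) (f2P k) _.
  by have := congr1 (fun s : {perm _} => s (false, k)) prodE; rewrite !permM !prod_tau_fix.
move=> j; rewrite ltnS leq_eqVlt => /predU1P[jm|].
  by have -> : j = k by apply: val_inj.
by apply: IH (ltnW lemn) _ j; apply: mulIg (expgz (tau k) (f1 k)) _ _ _; rewrite {2}fk.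
Qed.

Theorem theorem2p1p5 (n : nat) (n_ge1 : (1 <= n)%N)
    (g : {perm (spt n)}) (gB : g \in signed_perms n) :
  exists! i : {ffun 'I_n -> int},
    (forall k : 'I_n, ((- (k.+1)%:Z <= i k) && (i k < (k.+1)%:Z))%R) /\
    g = \prod_(k < n) expgz (tau k) (i k).
Proof.
(* Inserting the vacuous condition [k < n] turns the full product into the partial product with
   [m = n]. *)
have prodE (f : 'I_n -> int) : \prod_(k < n) expgz (tau k) (f k) =
    \prod_(k < n | (k < n)%N) expgz (tau k) (f k).
  by apply: eq_bigl => k; rewrite ltn_ord.
have [p|f fP gE] := prod_tau_exists (leqnn n) gB.
  by rewrite leqNgt ltn_ord.
exists [ffun k => f k]; split=> [|i [iP gEi]].
  split=> [k|]; first by rewrite ffunE.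
  by rewrite prodE gE; apply: eq_bigr => k _; rewrite ffunE.
apply/ffunP => k; rewrite ffunE; apply: (prod_tau_inj (leqnn n) fP iP) => //.
by rewrite -gE -prodE.
Qed.
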